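(* Let $X=E\times D$ be the economic state space with $\sigma$-algebra $\mathcal{X}$, let $q:E\times\mathcal{E}\to[0,1]$ be a Markov transition probability on the exogenous space $(E,\mathcal{E})$, and let $F$ be an upper hemicontinuous correspondence from $X\times E$ to $X$. Suppose: 1. there exists $K\in\mathcal{X}$ such that $f(x,e)\in K$ for all $e\in E$, all $x\in X$ and all measurable selections $f$ from $F$; 2. there exist $e^*\in E$, $x^*\in X$ and $n\in\mathbb{N}$ such that $f^{(n)}(x,e^* )=x^*$ for all $x\in K$ and all measurable selections $f$ from $F$; 3. there exists $\epsilon>0$ such that $q(e,\{e^*\})\ge\epsilon$ for all $e\in E$. Then, for every measurable selection $f$ from $F$, the transition probability $p$ on $(X,\mathcal{X})$ induced by $f$ and $q$ is ergodic.
   Context: Setting. A state of the economy is $x_t=(e_t,d_t)\in X=E\times D$, with $e_t$ exogenous and $d_t$ endogenous; $E$ and $X$ carry topologies and (Borel) $\sigma$-algebras $\mathcal{E}$, $\mathcal{X}$. The exogenous process $(e_t)_{t\ge0}$ is a Markov process on $(E,\mathcal{E})$ with transition probability $q$. A law of evolution is a measurable selection $f:X\times E\to X$ from $F$ (i.e. $f$ is measurable and $f(x,e)\in F(x,e)$), and the state evolves by $x_t=(e_t,d_t)=f(x_{t-1},e_t)$ (so the $E$-component of $f(x,e)$ is $e$). Iterates with the exogenous variable held fixed are defined by $f^{(1)}=f$ and $f^{(n)}(x,e):=f(f^{(n-1)}(x,e),e)$. The transition probability induced by $f$ and $q$ is $p:X\times\mathcal{X}\to[0,1]$, $p(x,A):=q\big(e_x,\{e\in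 E: f(x,e)\in A\}\big)$, where $e_x$ is the exogenous ($E$-)component of $x$. $(M)$ is the Banach space of complex-valued countably additive set functions on $(X,\mathcal{X})$ with the variation norm; $p$ induces the Markov operator $T\mu(A):=\int_X\mu(dt)p(t,A)$ on $(M)$, with iterates $T^i$ and $T^0=I$. The transition probability $p$ is ergodic if there exists a unique probability measure $\mu^*$ on $(X,\mathcal{X})$ such that $\frac1n\sum_{i=0}^{n-1}T^i\mu$ converges to $\mu^*$ in variation norm for every probability measure $\mu$ on $(X,\mathcal{X})$. *)

(* Defs.v *)
From HB Require Import structures.
From mathcomp Require Import all_boot all_order all_algebra.
From mathcomp Require Import all_classical all_reals all_analysis measurable_realfun.

Set Implicit Arguments.
Unset Strict Implicit.
Unset Printing Implicit Defensive.
Import Order.TTheory GRing.Theory Num.Theory.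
Import numFieldNormedType.Exports.
Local Open Scope classical_set_scope.
Local Open Scope ring_scope.
Local Open Scope ereal_scope.

(* For state spaces E and D, [borel (E * D)] is the Borel sigma-algebra of the
   product topology, whereas [borel (E * D) * borel E] carries the product of
   the two Borel sigma-algebras. *)
Notation borel T := (g_sigma_algebraType (@open T%type)).

Notation state_map E D :=
  {mfun (borel (E * D) * borel E)%type >-> borel (E * D)}.

(* F z may be empty, but F then has no selection. *)
Definition upper_hemicontinuous (S T : topologicalType) (F : S -> set T) :=
  forall z (V : set T), open V -> F z `<=` V -> \forall u \near z, F u `<=` V.

Definition selection (S T : Type) (F : S -> set T) (f : S -> T) :=
  forall z, F z (f z).

(* The iterate f^(n) with the exogenous variable held fixed: f^(0)(x, e) = x and
   f^(n+1)(x, e) = f (f^(n)(x, e), e). *)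
Definition law_iter (X E : Type) (f : X * E -> X) (n : nat) (x : X) (e : E) : X :=
  iter n (fun y => f (y, e)) x.

Section induced_transition.
Context (R : realType) (E D : ptopologicalType).
Local Notation X := (borel (E * D)).
Variables (q : R.-pker (borel E) ~> (borel E)) (f : state_map E D).

Definition transition (x : X) (A : set X) : \bar R :=
  q x.1 [set e | A (f (x, e))].

Let section_measurable x A : measurable A ->
  measurable ([set e | A (f (x, e))] : set (borel E)).
Proof.
move=> mA; have mfx : measurable_fun [set: borel E] (fun e => f (x, e)).
  exact: (measurableT_comp (measurable_funPT f) (pair1_measurable x)).
by have := mfx measurableT A mA; rewrite setTI.
Qed.

Let transition0 x : transition x set0 = 0.
Proof. exact: measure0. Qed.

Let transition_ge0 x A : 0 <= transition x A.
Proof. exact: measure_ge0. Qed.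

Let transition_sigma_additive x : semi_sigma_additive (transition x).
Proof.
move=> A mA tA mUA; rewrite /transition.
have -> : [set e | (\bigcup_n A n) (f (x, e))] =
          \bigcup_n [set e | A n (f (x, e))] by [].
apply: measure_semi_sigma_additive.
- by move=> n; exact: section_measurable.
- apply/trivIsetP => i j _ _ ij; apply/seteqP; split => // e /= [Ai Aj].
  by have /trivIsetP/(_ i j I I ij) := tA; rewrite -subset0; apply; split; [exact: Ai|].
- exact: (section_measurable _ mUA).
Qed.

HB.instance Definition _ x := isMeasure.Build _ _ R (transition x)
  (transition0 x) (transition_ge0 x) (@transition_sigma_additive x).

Definition mtransition (x : X) : {measure set X -> \bar R} := transition x.

Let measurable_exogenous : measurable_fun [set: X] (fst : X -> borel E).
Proof.
apply: (@measurability _ _ X (borel E) setT _ (@open E)) => // _ [A oA <-].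
apply: sub_sigma_algebra; rewrite setTI.
by apply: open_comp => // -[x1 x2] _; exact: cvg_fst.
Qed.

Let kq (x : X) : {measure set (borel E) -> \bar R} := q x.1.

Let measurable_kq U : measurable U -> measurable_fun [set: X] (kq ^~ U).
Proof.
move=> mU; exact: (measurableT_comp (measurable_kernel q U mU) measurable_exogenous).
Qed.

HB.instance Definition _ :=
  isKernel.Build _ _ X (borel E) R kq measurable_kq.

Let kq_setT x : kq x [set: borel E] = 1.
Proof. exact: prob_kernel. Qed.

HB.instance Definition _ :=
  Kernel_isProbability.Build _ _ X (borel E) R kq kq_setT.

Let measurable_transition U : measurable U ->
  measurable_fun [set: X] (mtransition ^~ U).
Proof.
move=> mU.
have mfU : measurable (f @^-1` U).
  by rewrite -[X in measurable X]setTI; exact: (measurable_funPT f).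
rewrite (_ : _ ^~ U = fun x => kq x (xsection (f @^-1` U) x)).
  by apply: measurable_fun_xsection_finite_kernel; rewrite inE.
by apply/funext => x; rewrite /= /transition xsectionE.
Qed.

HB.instance Definition _ :=
  isKernel.Build _ _ X X R mtransition measurable_transition.

Let mtransition_setT x : mtransition x [set: X] = 1.
Proof. exact: (@prob_kernel _ _ _ _ _ q). Qed.

HB.instance Definition _ :=
  Kernel_isProbability.Build _ _ X X R mtransition mtransition_setT.

Definition induced_kernel : R.-pker X ~> X := mtransition.

End induced_transition.

(* The Markov operator T on complex measures is only ever applied to probability
   measures in the definition of ergodicity, so it is given here as the
   restriction of T to them. *)
Section markov_operator.
Context d (X : measurableType d) (R : realType).
Variables (p : R.-pker X ~> X).

Section markov_operator_probability.
Variable mu : probability X R.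

Definition markov_op (A : set X) : \bar R := \int[mu]_t p t A.

Let markov_op0 : markov_op set0 = 0.
Proof. by apply: integral0_eq => t _; rewrite measure0. Qed.

Let markov_op_ge0 A : 0 <= markov_op A.
Proof. exact: integral_ge0. Qed.

Let markov_op_sigma_additive : semi_sigma_additive markov_op.
Proof.
move=> A mA tA mUA.
rewrite [X in _ --> X](_ : _ = \int[mu]_t \sum_(n <oo) p t (A n)); last first.
  by apply: eq_integral => t _; apply/esym/cvg_lim => //;
    exact/measure_semi_sigma_additive.
apply/cvg_closeP; split.
  by apply: is_cvg_nneseries => n _ _; exact: integral_ge0.
rewrite closeE// integral_nneseries// => n.
exact: measurable_kernel.
Qed.

HB.instance Definition _ := isMeasure.Build _ _ R markov_op
  markov_op0 markov_op_ge0 markov_op_sigma_additive.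

Let markov_op_setT : markov_op [set: X] = 1.
Proof.
rewrite /markov_op (eq_integral (cst 1)) => [|t _]; last exact: prob_kernel.
by rewrite integral_cst//= probability_setT mule1.
Qed.

HB.instance Definition _ :=
  Measure_isProbability.Build _ _ R markov_op markov_op_setT.

End markov_operator_probability.

Definition T_op (mu : probability X R) : probability X R := markov_op mu.

(* The value at n = 0 is 0 and plays no role. *)
Definition cesaro (mu : probability X R) (n : nat) (A : set X) : R :=
  (n%:R^-1 * \sum_(0 <= i < n) fine (iter i T_op mu A))%R.

End markov_operator.

(* Total variation over X, as the supremum over finite families of pairwise
   disjoint measurable sets; it is applied below to differences of (averages of)
   probability measures, which are real-valued. *)
Definition variation_norm d (X : measurableType d) (R : realType)
    (nu : set X -> R) : \bar R :=
  ereal_sup [set v | exists (m : nat) (A : 'I_m -> set X),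
    [/\ forall i, measurable (A i), trivIset [set: 'I_m] A &
        v = (\sum_(i < m) `|nu (A i)|)%:E]].

Definition cesaro_cvg d (X : measurableType d) (R : realType)
    (p : R.-pker X ~> X) (mustar : probability X R) :=
  forall mu : probability X R,
    variation_norm (fun A => cesaro p mu n A - fine (mustar A))%R
      @[n --> \oo] --> 0.

(* Uniqueness is equality on measurable sets: values of a [probability] on
   nonmeasurable sets are not constrained. *)
Definition ergodic d (X : measurableType d) (R : realType) (p : R.-pker X ~> X) :=
  exists mustar : probability X R, cesaro_cvg p mustar /\
    forall nu : probability X R, cesaro_cvg p nu ->
      forall A, measurable A -> nu A = mustar A.

(* Main.v *)
Require Import Defs.
From HB Require Import structures.
From mathcomp Require Import all_boot all_order all_algebra.
From mathcomp Require Import all_classical all_reals all_analysis measurable_realfun.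
From mathcomp Require Import ring lra.

Set Implicit Arguments.
Unset Strict Implicit.
Unset Printing Implicit Defensive.
Import Order.TTheory GRing.Theory Num.Theory.
Import numFieldNormedType.Exports.
Local Open Scope classical_set_scope.
Local Open Scope ring_scope.
Local Open Scope ereal_scope.

(** Doeblin's argument. Holding the exogenous variable at [estar] has
    probability at least [eps] in every period. One period brings the state into
    [K], whatever it was, and [n] more periods at [estar] then bring it to
    [xstar]; so after [n.+1] periods every initial law gives mass at least
    [c = eps ^+ n.+1] to every measurable set containing [xstar]
    ([induced_kernel_minorized]).

    Such a minorization makes the laws forget their origin. For a fixed
    measurable [A], the possible values of [T^k mu A], as [mu] ranges over all
    initial laws, lie in an interval. [N = n.+1] further periods average the
    function [x |-> T^k \d_x A] against a law that gives weight at least [c] to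
    the upper level set of its value at [xstar], hence pull the lower end of the
    interval towards that value by the factor [c] ([raise_lower_bound]). The same
    for [~` A] pulls the upper end down, so the interval shrinks by the factor
    [1 - c] every [N] periods, at a rate independent of [A]
    ([iter_T_op_contraction]).

    Comparing [T^k mu] with [T^k (T^l mu)] shows that the iterates are uniformly
    Cauchy on measurable sets; a setwise uniform limit of probabilities is a
    probability ([uniform_limit_probability]), which gives the limit law. The
    uniform bounds pass to Cesaro means, and from single sets to the variation
    norm at the price of a factor 2 ([variation_norm_le]). *)

(** * Duality for the Markov operator *)

(** [T_op p mu] is the composite of the constant kernel [mu] with [p], seen as a
    kernel that ignores its first argument. *)
Lemma integral_T_op d (X : measurableType d) (R : realType) (p : R.-pker X ~> X)
    (mu : probability X R) (u : X -> \bar R) :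
  (forall x, 0 <= u x) -> measurable_fun [set: X] u ->
  \int[T_op p mu]_x u x = \int[mu]_x \int[p x]_y u y.
Proof.
move=> u0 u_meas.
pose l := kprobability
  (measurable_cst (mu : pprobability X R) : measurable_fun [set: X] _).
exact: (integral_kcomp l (kernel.kernel_snd p) point u0 u_meas).
Qed.

(** The law at time [k] is the mixture, over the initial state, of the laws
    started from points. Measurability of the integrand is proved in the same
    induction, since the mixture formula at time [k] is what shows it at time
    [k.+1]. *)
Lemma iter_T_op_mixture d (X : measurableType d) (R : realType)
    (p : R.-pker X ~> X) k A : measurable A ->
  measurable_fun [set: X] (fun x => iter k (T_op p) (\d_x : probability X R) A) /\
  forall mu : probability X R,
    iter k (T_op p) mu A = \int[mu]_x iter k (T_op p) (\d_x : probability X R) A.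
Proof.
move=> mA; elim: k => [|k [mg IH]].
  split=> [|mu] /=; first exact: measurable_fun_dirac.
  rewrite (eq_integral (fun x => (\1_A x)%:E)) => [|x _]; last by rewrite diracE.
  by rewrite integral_indic// setIT.
have gS (x : X) : iter k.+1 (T_op p) (\d_x : probability X R) A =
    \int[p x]_y iter k (T_op p) (\d_y : probability X R) A.
  rewrite iterSr IH integral_T_op// integral_dirac//; last first.
    apply: measurable_fun_integral_kernel => // U mU.
    exact: measurable_kernel p U mU.
  by rewrite diracT mul1e.
split.
  rewrite (_ : (fun x => _) = fun x =>
    \int[p x]_y iter k (T_op p) (\d_y : probability X R) A); last exact/funext.
  apply: measurable_fun_integral_kernel => // U mU.
  exact: measurable_kernel p U mU.
move=> mu; rewrite iterSr IH integral_T_op//.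
by apply: eq_integral => x _; rewrite gS.
Qed.

(** * Contraction under a point minorization *)

(** Doeblin's condition with the point mass at [xstar] as minorizing measure. It
    is phrased through the sets that contain [xstar] because [[set xstar]] may
    fail to be measurable. *)
Definition minorized_at d (X : measurableType d) (R : realType)
    (p : R.-pker X ~> X) (N : nat) (c : R) (xstar : X) :=
  forall (mu : probability X R) A, measurable A -> A xstar ->
    c%:E <= iter N (T_op p) mu A.

Section contraction.
Context d (X : measurableType d) (R : realType) (p : R.-pker X ~> X).
Variables (N : nat) (c : R) (xstar : X).
Hypotheses (c_ge0 : (0 <= c)%R) (pc : minorized_at p N c xstar).

(** The function [g x := T^k \d_x A] is at least [a] everywhere, and at least
    [g xstar] on a set of mass [c] under the law at time [N]; integrate. *)
Lemma raise_lower_bound k A (a : R) : measurable A -> (0 <= a)%R ->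
  (forall mu : probability X R, a%:E <= iter k (T_op p) mu A) ->
  forall mu : probability X R,
    (a + c * (fine (iter k (T_op p) (\d_xstar : probability X R) A) - a))%:E
      <= iter (k + N) (T_op p) mu A.
Proof.
move=> mA a0 ha mu; rewrite iterD.
have [mg mix] := iter_T_op_mixture p k mA.
move: (pc mu); move: (iter N _ mu) => {mu}m pm; rewrite (mix m).
set g := fun x => iter k (T_op p) (\d_x : probability X R) A.
pose B := [set x | g xstar <= g x].
have mB : measurable B by rewrite -[B]setTI; exact: emeasurable_fun_c_infty.
have mBc : c%:E <= m B by apply: pm => //; rewrite /B/=.
have gfin : g xstar \is a fin_num by exact: fin_num_measure.
pose t := (fine (g xstar) - a)%R.
have t0 : (0 <= t)%R by rewrite subr_ge0 -lee_fin fineK// ha.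
have it : \int[m]_x (a%:E + t%:E * (\1_B x)%:E) = a%:E + t%:E * m B.
  rewrite ge0_integralD//=; first last.
  - by apply: measurable_funeM; apply/measurable_EFinP.
  - by move=> x _; rewrite mule_ge0 ?lee_fin.
  rewrite ge0_integralZl//; last exact/measurable_EFinP.
  by rewrite integral_indic// setIT integral_cst//= probability_setT mule1.
apply: (@le_trans _ _ (a%:E + t%:E * m B)).
  rewrite EFinD leeD2l// mulrC EFinM.
  by rewrite lee_pmul// ?lee_fin.
rewrite -it; apply: ge0_le_integral => //.
- by move=> x _; rewrite adde_ge0 ?mule_ge0 ?lee_fin.
- apply: emeasurable_funD => //.
  by apply: measurable_funeM; apply/measurable_EFinP.
move=> x _; rewrite indicE; case: (boolP (x \in B)) => [|_].
  by rewrite inE /B/= mule1 -EFinD /t addrC subrK fineK.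
by rewrite mule0 adde0 ha.
Qed.

(** The laws after [j] blocks of [N] periods give [A] a mass between [a] and
    [1 - b]. The upper end is encoded as a lower bound on [~` A] so that
    [raise_lower_bound] moves both ends. *)
Lemma complementary_lower_bounds j A : measurable A ->
  exists a b : R, [/\ (0 <= a)%R, (0 <= b)%R, (a + b = 1 - (1 - c) ^+ j)%R &
    forall mu : probability X R, a%:E <= iter (j * N) (T_op p) mu A /\
                                 b%:E <= iter (j * N) (T_op p) mu (~` A)].
Proof.
move=> mA; elim: j => [|j [a [b [a0 b0 ab hab]]]].
  exists 0%R, 0%R; split => //; first by rewrite expr0 addr0 subrr.
pose s := fine (iter (j * N) (T_op p) (\d_xstar : probability X R) A).
have sC : fine (iter (j * N) (T_op p) (\d_xstar : probability X R) (~` A)) =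
    (1 - s)%R.
  by rewrite probability_setC// fineB// fin_num_measure.
have sa : (a <= s)%R.
  by rewrite -lee_fin fineK ?fin_num_measure//; have [] := hab (\d_xstar).
have sb : (b <= 1 - s)%R.
  rewrite -sC -lee_fin fineK ?fin_num_measure//; last exact: measurableC.
  by have [] := hab (\d_xstar).
exists (a + c * (s - a))%R, (b + c * (1 - s - b))%R; split.
- by rewrite addr_ge0// mulr_ge0// subr_ge0.
- by rewrite addr_ge0// mulr_ge0// subr_ge0.
- rewrite exprS.
  have -> : ((1 - c) ^+ j = 1 - (a + b))%R by rewrite ab; ring.
  by ring.
move=> mu; rewrite mulSn addnC; split.
  by apply: raise_lower_bound => // nu; have [] := hab nu.
rewrite -sC; apply: raise_lower_bound => //; first exact: measurableC.
by move=> nu; have [] := hab nu.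
Qed.

(** Only the full blocks of [N] periods contract; the remaining [k %% N] periods
    are absorbed into the initial laws. *)
Lemma iter_T_op_contraction k A (mu nu : probability X R) : measurable A ->
  (`|fine (iter k (T_op p) mu A) - fine (iter k (T_op p) nu A)|
    <= (1 - c) ^+ (k %/ N))%R.
Proof.
move=> mA; rewrite {1 2}(divn_eq k N) !iterD.
move: (iter (k %% N) _ mu) (iter (k %% N) _ nu) => {}mu {}nu.
have [a [b [_ _ ab hab]]] := complementary_lower_bounds (k %/ N) mA.
have bnd (m : probability X R) :
    (a <= fine (iter (k %/ N * N) (T_op p) m A) <= 1 - b)%R.
  have [lo hi] := hab m.
  have mfin := fin_num_measure (iter (k %/ N * N) (T_op p) m) A mA.
  rewrite -!lee_fin fineK// lo/=; move: hi.
  rewrite probability_setC// -(fineK mfin) -EFinB !lee_fin; lra.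
move: (bnd mu) (bnd nu) => /andP[? ?] /andP[? ?].
by rewrite ler_norml; apply/andP; split; lra.
Qed.

End contraction.

(** * Uniform limits of probabilities *)

(** Uniformity in [A] is what carries countable additivity to the limit: [P_ k]
    for one large [k] approximates the limit on a union and on all its partial
    unions at once. *)
Lemma uniform_limit_probability d (X : measurableType d) (R : realType)
    (P_ : nat -> probability X R) (r : R^nat) : r @ \oo --> 0%R ->
  (forall n k A, measurable A ->
    (`|fine (P_ n A) - fine (P_ (n + k)%N A)| <= r n)%R) ->
  exists P : probability X R, forall n A, measurable A ->
    (`|fine (P_ n A) - fine (P A)| <= r n)%R.
Proof.
move=> r0 hP.
(* An upper limit is nonnegative even on a nonmeasurable set, where the sequence
   may diverge; on measurable sets it is the real limit [l]. *)
pose L A := limn_esup (fun n => P_ n A).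
pose l A := limn (fun n => fine (P_ n A)).
have cl A : measurable A -> fine (P_ n A) @[n --> \oo] --> l A.
  move=> mA; apply: cauchy_cvg; apply: cauchy_exP => e e0.
  move/cvgrPdist_lt : r0 => /(_ e e0) [m _ /(_ m (leqnn m))].
  rewrite /= sub0r normrN => rm.
  exists (fine (P_ m A)); exists m => // n /= mn.
  rewrite /ball/= (le_lt_trans _ rm)// (le_trans _ (ler_norm _))//.
  by rewrite -(subnKC mn) hP.
have LE A : measurable A -> L A = (l A)%:E.
  move=> mA; have : P_ n A @[n --> \oo] --> (l A)%:E.
    by apply: cvg_EFin; [apply: nearW => n; rewrite fin_num_measure|exact: cl].
  by move=> /cvg_limn_einf_sup[_].
have hl n A : measurable A -> (`|fine (P_ n A) - l A| <= r n)%R.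
  move=> mA.
  have h : (`|fine (P_ n A) - fine (P_ k A)| @[k --> \oo] -->
      `|fine (P_ n A) - l A|)%R.
    by apply: cvg_norm; apply: cvgB (cl _ mA); exact: cvg_cst.
  apply: (cvgr_to_le h); exists n => // k /= nk.
  by rewrite -(subnKC nk) hP.
have L0 : L set0 = 0.
  rewrite LE//; congr EFin; apply/cvg_lim => //.
  by under eq_fun do rewrite measure0; exact: cvg_cst.
have Lge0 A : 0 <= L A.
  rewrite /L limn_esup_lim; apply: lime_ge; first exact: is_cvg_esups.
  apply: nearW => n; apply: (@le_trans _ _ (P_ n A)) => //.
  by apply: ereal_sup_ubound; exists n => /=.
have Lsa : semi_sigma_additive L.
  move=> F mF tF mUF.
  pose V n := \big[setU/set0]_(i < n) F i.
  have mV n : measurable (V n) by exact: bigsetU_measurable.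
  have PV k n : (\sum_(i < n) fine (P_ k (F i)))%R = fine (P_ k (V n)).
    rewrite measure_bigsetU// -sum_fine// => i _; exact: fin_num_measure.
  have lV n : (\sum_(i < n) l (F i))%R = l (V n).
    apply/esym/cvg_lim => //; under eq_fun do rewrite -PV.
    by apply: cvg_big => [|i _]; [exact: add_continuous|exact: cl].
  have -> : (fun n => \sum_(0 <= i < n) L (F i)) = (fun n => (l (V n))%:E).
    apply/funext => n; rewrite -lV big_mkord -sumEFin.
    by apply: eq_bigr => i _; rewrite LE.
  rewrite LE//; apply: cvg_EFin; first exact: nearW.
  apply/cvgrPdist_le => e e0.
  have /cvgrPdist_le/(_ (e / 3)%R)[|k _ /(_ k (leqnn k))] := r0.
    by rewrite divr_gt0.
  rewrite /= sub0r normrN => /(le_trans (ler_norm _)) rk.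
  have PkV : fine (P_ k (V n)) @[n --> \oo] --> fine (P_ k (\bigcup_n F n)).
    apply: fine_cvg; rewrite fineK ?fin_num_measure//.
    have := @measure_semi_sigma_additive _ _ _ (P_ k) F mF tF mUF.
    by under eq_fun do rewrite big_mkord -measure_bigsetU//.
  move/cvgrPdist_le : PkV => /(_ (e / 3)%R).
  rewrite divr_gt0// => /(_ isT) hk; near=> n.
  have h1 : (`|fine (P_ k (\bigcup_n F n)) - fine (P_ k (V n))| <= e / 3)%R.
    by near: n.
  have h2 := hl k _ (mV n); have h3 := hl k _ mUF.
  move: h1 h2 h3; rewrite !ler_norml => /andP[? ?] /andP[? ?] /andP[? ?].
  by apply/andP; split; lra.
pose Lm := isMeasure.Build _ _ R L L0 Lge0 Lsa.
pose M : {measure set X -> \bar R} := HB.pack L Lm.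
have LT : M setT = 1.
  rewrite /M/= LE//; congr EFin; apply/cvg_lim => //.
  by under eq_fun do rewrite probability_setT; exact: cvg_cst.
pose Pm := Measure_isProbability.Build _ _ R M LT.
pose P : probability X R := HB.pack L Lm Pm.
exists P => n A mA /=.
by rewrite /P/= LE//; exact: hl.
Unshelve. all: by end_near. Qed.

(** * Variation norm and Cesaro means *)

(** Separate the sets of positive and of negative value: the absolute values of
    each kind add up to the absolute value at a union. *)
Lemma variation_norm_le d (X : measurableType d) (R : realType)
    (nu : set X -> R) (r : R) :
  (forall m (P : {pred 'I_m}) (A : 'I_m -> set X),
    (forall i, measurable (A i)) -> trivIset setT A ->
    nu (\big[setU/set0]_(i < m | P i) A i) = \sum_(i < m | P i) nu (A i))%R ->
  (forall A, measurable A -> `|nu A| <= r)%R ->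
  variation_norm nu <= (2 * r)%:E.
Proof.
move=> nuU nur; apply: ub_ereal_sup => _ [m [A [mA tA ->]]]; rewrite lee_fin.
rewrite (bigID (fun i => 0 <= nu (A i)))%R/= mulr_natl mulr2n lerD//.
  rewrite (eq_bigr (fun i => nu (A i))) => [|i /ger0_norm//].
  rewrite -nuU// (le_trans (ler_norm _))// nur//.
  exact: bigsetU_measurable.
rewrite (eq_bigr (fun i => - nu (A i)))%R => [|i]; last first.
  by rewrite -ltNge => /ltr0_norm.
rewrite sumrN -nuU// (le_trans (ler_norm _))// normrN nur//.
exact: bigsetU_measurable.
Qed.

Lemma ge_variation_norm d (X : measurableType d) (R : realType)
    (nu : set X -> R) A : measurable A -> `|nu A|%:E <= variation_norm nu.
Proof.
move=> mA; apply: ereal_sup_ubound; exists 1%N, (fun=> A); split => //.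
- by apply/trivIsetP => i j _ _; rewrite !ord1 eqxx.
- by rewrite big_ord1.
Qed.

Section uniform_convergence.
Context d (X : measurableType d) (R : realType) (p : R.-pker X ~> X).

Lemma cesaro_bigsetU (mu : probability X R) n m (P : {pred 'I_m})
    (A : 'I_m -> set X) :
  (forall i, measurable (A i)) -> trivIset setT A ->
  (Defs.cesaro p mu n (\big[setU/set0]_(i < m | P i) A i) =
   \sum_(i < m | P i) Defs.cesaro p mu n (A i))%R.
Proof.
move=> mA tA; rewrite /Defs.cesaro -mulr_sumr exchange_big/=; congr *%R.
apply: eq_bigr => k _; rewrite measure_bigsetU_ord// -sum_fine// => i _.
exact: fin_num_measure.
Qed.

Lemma cesaro_cvg_uniform (mustar : probability X R) (r : R^nat) :
  r @ \oo --> 0%R ->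
  (forall (mu : probability X R) k A, measurable A ->
    `|fine (iter k (T_op p) mu A) - fine (mustar A)| <= r k)%R ->
  cesaro_cvg p mustar.
Proof.
move=> r0 hr mu.
pose s n := (n%:R^-1 * \sum_(0 <= i < n) r i)%R.
have s0 : s @ \oo --> 0%R.
  rewrite -(cvg_shiftS s); exact: sequences.cesaro r0.
have hs n A : (0 < n)%N -> measurable A ->
    (`|Defs.cesaro p mu n A - fine (mustar A)| <= s n)%R.
  move=> n0 mA; have nR : (n%:R != 0 :> R)%R by rewrite pnatr_eq0 -lt0n.
  have -> : (Defs.cesaro p mu n A - fine (mustar A) =
    n%:R^-1 * \sum_(0 <= i < n) (fine (iter i (T_op p) mu A) - fine (mustar A)))%R.
    rewrite sumrB mulrBr; congr (_ - _)%R.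
    by rewrite sumr_const_nat subn0 -(mulr_natl (fine _)) mulKf.
  rewrite normrM ger0_norm ?invr_ge0// ler_wpM2l ?invr_ge0//.
  by rewrite (le_trans (ler_norm_sum _ _ _))//; apply: ler_sum => i _; exact: hr.
apply: (@squeeze_cvge _ _ _ _ (cst 0) _ (fun n => (2 * s n)%:E)).
(* The empty mean at [n = 0] is null, hence not within [s 0] of [mustar]. *)
- exists 1%N => // n /= n0; apply/andP; split.
    exact: (le_trans _ (ge_variation_norm _ measurable0)).
  apply: variation_norm_le => [m P A mA tA|A mA]; last exact: hs.
  rewrite cesaro_bigsetU// sumrB measure_bigsetU_ord// -sum_fine// => i _.
  exact: fin_num_measure.
- exact: cvg_cst.
- apply: cvg_EFin; first exact: nearW.
  rewrite -[X in _ --> X](mulr0 (2%R : R)); apply: cvgM => //; exact: cvg_cst.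
Qed.

(** The variation norm dominates the values on each measurable set, and real
    limits are unique. *)
Lemma cesaro_cvg_unique (m1 m2 : probability X R) :
  cesaro_cvg p m1 -> cesaro_cvg p m2 ->
  forall A, measurable A -> m1 A = m2 A.
Proof.
move=> h1 h2 A mA.
have lim_cesaro (m : probability X R) : cesaro_cvg p m ->
    Defs.cesaro p m1 n A @[n --> \oo] --> fine (m A).
  move=> hm; apply/cvgrPdist_le => e e0; near=> n.
  rewrite distrC -lee_fin.
  apply: (le_trans (ge_variation_norm
    (fun A => Defs.cesaro p m1 n A - fine (m A))%R mA)).
  near: n.
  have /fine_cvgP[fin] := hm m1.
  move=> /cvgrPdist_le/(_ e e0); apply: filterS2 fin => n fin.
  rewrite sub0r normrN => /(le_trans (ler_norm _)).
  by rewrite -lee_fin fineK.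
have e12 := cvg_unique (@Rhausdorff R) (lim_cesaro _ h1) (lim_cesaro _ h2).
by rewrite -[LHS]fineK ?e12 ?fineK ?fin_num_measure.
Unshelve. all: by end_near. Qed.

Lemma uniform_ergodic (mustar : probability X R) (r : R^nat) :
  r @ \oo --> 0%R ->
  (forall (mu : probability X R) k A, measurable A ->
    `|fine (iter k (T_op p) mu A) - fine (mustar A)| <= r k)%R ->
  ergodic p.
Proof.
move=> r0 /(cesaro_cvg_uniform r0) cvgm.
by exists mustar; split=> // nu cvgnu A; exact: cesaro_cvg_unique.
Qed.

(** Apply the contraction to [\d_xstar] and [T^l \d_xstar] for the existence of
    the limit, then to [\d_xstar] and [mu] for its independence of [mu]. *)
Lemma minorized_ergodic (N : nat) (c : R) (xstar : X) :
  (0 < N)%N -> (0 < c)%R -> minorized_at p N c xstar -> ergodic p.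
Proof.
move=> N0 c0 pc.
have c1 : (c <= 1)%R.
  by have := pc (\d_xstar) _ measurableT I; rewrite probability_setT lee_fin.
have c_ge0 := ltW c0.
pose r k := ((1 - c) ^+ (k %/ N))%R.
have r0 : r @ \oo --> 0%R.
  apply: (@cvg_comp _ _ _ (fun k => k %/ N)%N (fun j => (1 - c) ^+ j)%R).
    exact: cvg_divnr.
  by apply: cvg_expr; rewrite ger0_norm ?subr_ge0// ltrBlDr ltrDl.
pose P_ n := iter n (T_op p) (\d_xstar : probability X R).
have [n k A mA|P hP] := uniform_limit_probability r0 (P_ := P_).
  by rewrite /P_ iterD; exact: (iter_T_op_contraction c_ge0 pc).
apply: (@uniform_ergodic P (fun k => r k + r k)%R) => [|mu k A mA].
  by rewrite -[X in _ --> X](addr0 (0 : R)%R); exact: cvgD.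
apply: (le_trans (ler_distD (fine (P_ k A)) _ _)); rewrite lerD ?hP//.
exact: (iter_T_op_contraction c_ge0 pc).
Qed.

End uniform_convergence.

(** * Minorization by holding the exogenous state *)

Section held_shock.
Context (R : realType) (E D : ptopologicalType).
Variables (q : R.-pker borel E ~> borel E) (f : state_map E D).
Variables (estar : borel E) (eps : R).
Hypotheses (mestar : measurable [set estar]) (eps_gt0 : (0 < eps)%R)
  (q_estar : forall e, eps%:E <= q e [set estar]).
Local Notation X := (borel (E * D)).
Local Notation T := (T_op (induced_kernel q f)).
Local Notation g := (fun x : X => f (x, estar)).

Lemma measurable_held_shock : measurable_fun [set: X] (g : X -> X).
Proof.
exact: (measurableT_comp (measurable_funPT f) (pair2_measurable estar)).
Qed.

(** If the exogenous state is drawn at [estar], the next state is [g x]. *)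
Lemma T_op_held_shock (mu : probability X R) A : measurable A ->
  eps%:E * mu (g @^-1` A) <= T mu A.
Proof.
move=> mA.
have mgA : measurable (g @^-1` A).
  by rewrite -[X in measurable X]setTI; exact: measurable_held_shock.
rewrite /T_op/= /markov_op.
rewrite -(setIT (g @^-1` A)) -integral_indic// -ge0_integralZl//; last 2 first.
- exact/measurable_EFinP.
- by rewrite lee_fin ltW.
apply: ge0_le_integral => //.
- by move=> x _; rewrite mule_ge0 ?lee_fin// ltW.
- by apply: measurable_funeM; exact/measurable_EFinP.
- exact: measurable_kernel.
move=> x _; rewrite indicE; case: (boolP (x \in _)) => [|_]; last by rewrite mule0.
rewrite inE/= mule1 => Agx; apply: (le_trans (q_estar x.1)).
rewrite /induced_kernel/mtransition/= /transition.
apply: le_measure; rewrite ?inE//; last by move=> _ ->.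
have mfx : measurable_fun [set: borel E] (fun e => f (x, e)).
  exact: (measurableT_comp (measurable_funPT f) (pair1_measurable x)).
by rewrite -[X in measurable X]setTI; exact: mfx.
Qed.

Lemma iter_T_op_held_shock k (mu : probability X R) A : measurable A ->
  (eps ^+ k)%:E * mu ((fun x => law_iter f k x estar) @^-1` A) <= iter k T mu A.
Proof.
elim: k A => [|k IH] A mA; first by rewrite expr0 mul1e.
have mgA : measurable (g @^-1` A).
  by rewrite -[X in measurable X]setTI; exact: measurable_held_shock.
rewrite iterS; apply: le_trans (T_op_held_shock _ mA).
rewrite exprS EFinM -muleA lee_pmul2l//.
exact: (IH _ mgA).
Qed.

Lemma induced_kernel_minorized k (xstar : X) :
  (forall x, law_iter f k x estar = xstar) ->
  minorized_at (induced_kernel q f) k (eps ^+ k) xstar.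
Proof.
move=> fk mu A mA Ax; apply: le_trans (iter_T_op_held_shock k mu mA).
rewrite (_ : _ @^-1` _ = setT); last by apply/seteqP; split => // x _ /=; rewrite fk.
by rewrite probability_setT mule1.
Qed.

End held_shock.

Theorem theorem2 (R : realType) (E D : ptopologicalType)
  (q : R.-pker borel E ~> borel E)
  (F : (E * D) * E -> set (E * D))
  (F_uhc : upper_hemicontinuous F)
  (F_exo : forall f : state_map E D, selection F f ->
     forall x e, (f (x, e)).1 = e)
  (K : set (borel (E * D))) (mK : measurable K)
  (H1 : forall f : state_map E D, selection F f -> forall x e, K (f (x, e)))
  (estar : borel E) (xstar : borel (E * D)) (n : nat) (n_gt0 : (0 < n)%N)
  (H2 : forall f : state_map E D, selection F f ->
     forall x, K x -> law_iter f n x estar = xstar)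
  (mestar : measurable [set estar])
  (H3 : exists2 eps : R, (0 < eps)%R & forall e, eps%:E <= q e [set estar]) :
  forall f : state_map E D, selection F f -> ergodic (induced_kernel q f).
Proof.
move=> f Ff; have [eps eps_gt0 q_estar] := H3.
apply: (@minorized_ergodic _ _ _ _ n.+1 (eps ^+ n.+1) xstar) => //.
  exact: exprn_gt0.
apply: (induced_kernel_minorized mestar eps_gt0 q_estar) => x.
(* The first of the [n.+1] steps enters [K] from an arbitrary state. *)
by rewrite /law_iter iterSr; apply: H2 => //; exact: H1.
Qed.
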